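(* Let $X$ be a locally compact non-compact metrizable space. Then $\lambda(\mathcal{E}(X))$ consists of exactly those non-empty zero-sets of $\beta X$ which miss $X$; that is, $\lambda(\mathcal{E}(X))=\{Z\in\mathcal{Z}(\beta X): Z\neq\emptyset,\ Z\cap X=\emptyset\}$.
   Context: For a non-compact metrizable space $X$, $\mathcal{E}(X)$ denotes the set of all one-point metrizable extensions of $X$, i.e. metrizable spaces $Y=X\cup\{p\}$ with $p\notin X$ containing $X$ as a dense subspace, where two such extensions are identified if there is a homeomorphism between them fixing $X$ pointwise. $\beta X$ is the Stone-Čech compactification of $X$; for $A\subseteq X$, $A^*=(\mathrm{cl}_{\beta X}A)\setminus X$, so $X^*=\beta X\setminus X$. $\mathcal{Z}(T)$ denotes the set of all zero-sets $f^{-1}(0)$ of continuous functions $f:T\to\mathbb{R}$. A sequence $\{U_n\}_{n<\omega}$ of non-empty open subsets of $X$ is an extension trace in $X$ if $\mathrm{cl}_XU_{n+1}\subseteq U_n$ for each $n$ and $\bigcap_nU_n=\emptyset$. It generates $Y=X\cup\{p\}\in\mathcal{E}(X)$ if $\{U_n\cup\{p\}\}_{n<\omega}$ is an open base at $p$ in $Y$; every extension trace generates an element of $\mathcal{E}(X)$ and every element of $\mathcal{E}(X)$ is generated by an extension trace. For locally compact $X$, the map $\lambda:\mathcal{E}(X)\to\mathcal{Z}(X^* )$ is $\lambda(Y)=\bigcap_{n<\omega}U_n^*$, where $\{U_n\}$ is any extension trace generating $Y$ (this is well-defined and injective). *)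

(* Defs.v *)
From HB Require Import structures.
From mathcomp Require Import all_boot all_order all_algebra.
From mathcomp Require Import all_classical all_reals all_analysis.

Set Implicit Arguments.
Unset Strict Implicit.
Unset Printing Implicit Defensive.

Import Order.TTheory GRing.Theory Num.Theory.
Import numFieldNormedType.Exports.

Local Open Scope classical_set_scope.
Local Open Scope ring_scope.

Definition is_metric (R : realType) (T : Type) (d : T -> T -> R) : Prop :=
  [/\ forall x, d x x = 0,
      forall x y, d x y = 0 -> x = y,
      forall x y, d x y = d y x &
      forall y x z, d x z <= d x y + d y z].

Definition metrizable (R : realType) (T : topologicalType) : Prop :=
  exists2 d : T -> T -> R, is_metric d &
    forall x : T,
      nbhs x = filter_from [set e : R | 0 < e] (fun e => [set y | d x y < e]).

Definition zero_sets (R : realType) (T : topologicalType) : set (set T) :=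
  [set Z | exists2 f : T -> R, continuous f & Z = f @^-1` [set 0]].
Arguments zero_sets R T _ : clear implicits.

Definition topological_embedding (S T : topologicalType) (e : S -> T) : Prop :=
  injective e /\ @open S = [set e @^-1` A | A in @open T].

Definition homeomorphism (S T : topologicalType) (h : S -> T) : Prop :=
  continuous h /\
  exists g : T -> S, [/\ continuous g, cancel h g & cancel g h].

(* The Stone-Cech compactification is the closure of the image of X in the cube
   [0, 1]^C(X, [0, 1]) under evaluation. For completely regular Hausdorff X (in
   particular for metrizable X) the map [sc_incl] is an embedding, through which
   X is regarded as a subspace of beta X. *)
Definition unit_interval (R : realType) : topologicalType :=
  set_type (`[0, 1]%classic : set R).

Definition sc_cube (R : realType) (X : topologicalType) : topologicalType :=
  prod_topology (fun _ : continuousType X (unit_interval R) => unit_interval R).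

Definition sc_eval (R : realType) (X : topologicalType) (x : X) : sc_cube R X :=
  fun f => f x.
Arguments sc_eval R {X} x.

Definition stone_cech (R : realType) (X : topologicalType) : topologicalType :=
  set_type (closure (range (@sc_eval R X))).

Definition sc_incl (R : realType) (X : topologicalType) (x : X) :
    stone_cech R X :=
  SigSub (mem_set (subset_closure (imageT (sc_eval R) x))).
Arguments sc_incl R {X} x.

Definition remainder (R : realType) (X : topologicalType) (A : set X) :
    set (stone_cech R X) :=
  closure (sc_incl R @` A) `\` range (sc_incl R).
Arguments remainder R {X} A.

(* The spaces Y = X u {p}; the containment of X in Y is the embedding [ext_incl],
   and [ext_pt] is the added point p. *)
Record extension_space (R : realType) (X : topologicalType) := ExtensionSpace {
  ext_space :> topologicalType;
  ext_incl : X -> ext_space;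
  ext_pt : ext_space;
  ext_metrizable : metrizable R ext_space;
  ext_embedding : topological_embedding ext_incl;
  ext_dense : dense (range ext_incl);
  ext_compl : ~` range ext_incl = [set ext_pt] }.

Definition ext_equiv (R : realType) (X : topologicalType)
    (Y1 Y2 : extension_space R X) : Prop :=
  exists2 h : Y1 -> Y2, homeomorphism h &
    forall x : X, h (ext_incl Y1 x) = ext_incl Y2 x.

(* E(X): the equivalence classes of [ext_equiv], given by their predicates. They
   are not stated as elements of [set (extension_space R X)] because [set] does
   not accept the universe of [topologicalType]. *)
Record one_point_extension (R : realType) (X : topologicalType) :=
  OnePointExtension {
    represented_by :> extension_space R X -> Prop;
    represented_class : exists Y, represented_by = ext_equiv Y }.

Definition extension_trace (X : topologicalType) (U : nat -> set X) : Prop :=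
  [/\ forall n, U n !=set0,
      forall n, open (U n),
      forall n, closure (U n.+1) `<=` U n &
      \bigcap_n U n = set0].

Definition generates (R : realType) (X : topologicalType) (U : nat -> set X)
    (Y : extension_space R X) : Prop :=
  let V n := ext_incl Y @` U n `|` [set ext_pt Y] in
  (forall n, open (V n)) /\
  forall W, nbhs (ext_pt Y) W -> exists n, V n `<=` W.

Definition trace_remainder (R : realType) (X : topologicalType)
    (U : nat -> set X) : set (stone_cech R X) :=
  \bigcap_n remainder R (U n).
Arguments trace_remainder R {X} U.

(* The value does not depend on the chosen trace, nor on the chosen
   representative of the class E, by [lambdaE] below. *)
Definition lambda (R : realType) (X : topologicalType)
    (E : one_point_extension R X) : set (stone_cech R X) :=
  xget set0 [set Z | exists (Y : extension_space R X) (U : nat -> set X),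
    [/\ E Y, extension_trace U, generates U Y & Z = trace_remainder R U]].

Lemma generates_sub (R : realType) (X : topologicalType) (U V : nat -> set X)
    (Y : extension_space R X) :
  generates U Y -> generates V Y -> forall n, exists m, V m `<=` U n.
Proof.
move=> [oU _] [_ bV] n.
have [|m sVU] := bV (ext_incl Y @` U n `|` [set ext_pt Y]).
  by apply: open_nbhs_nbhs; split; [exact: oU|right].
exists m => x Vx; have [|[y Uy]|/= xp] := sVU (ext_incl Y x).
- by left; exists x.
- by move/(proj1 (ext_embedding Y)) => <-.
- have : (~` range (ext_incl Y)) (ext_pt Y) by rewrite ext_compl.
  by rewrite -xp; case; exists x.
Qed.

Lemma trace_remainder_sub (R : realType) (X : topologicalType)
    (U V : nat -> set X) :
  (forall n, exists m, V m `<=` U n) ->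
  trace_remainder R V `<=` trace_remainder R U.
Proof.
move=> VU z Vz n _; have [m sVU] := VU n.
have [clz nz] := Vz m I; split => //.
by apply: closureS clz; exact: image_subset.
Qed.

Lemma generates_equiv (R : realType) (X : topologicalType) (U : nat -> set X)
    (Y1 Y2 : extension_space R X) :
  ext_equiv Y1 Y2 -> generates U Y1 -> generates U Y2.
Proof.
case=> h [ch [g [cg hK gK]]] hX [oU bU].
have gX x : g (ext_incl Y2 x) = ext_incl Y1 x by rewrite -hX hK.
have hp : h (ext_pt Y1) = ext_pt Y2.
  have : (~` range (ext_incl Y2)) (h (ext_pt Y1)).
    move=> [x _ xp]; have : (~` range (ext_incl Y1)) (ext_pt Y1).
      by rewrite ext_compl.
    by apply; exists x => //; rewrite -gX xp hK.
  by rewrite ext_compl.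
have VE n : ext_incl Y2 @` U n `|` [set ext_pt Y2] =
    g @^-1` (ext_incl Y1 @` U n `|` [set ext_pt Y1]).
  apply/seteqP; split => [y [[x Ux <-]|->]|y [[x Ux xy]|/= yp]] /=.
  - by left; exists x.
  - by right; rewrite -hp hK.
  - by left; exists x => //; rewrite -hX xy gK.
  - by right; rewrite /= -hp -yp gK.
split=> [n|W nW]; first by rewrite VE; move/continuousP : cg; apply; exact: oU.
have [|n sVW] := bU (h @^-1` W); first by apply: ch; rewrite hp.
by exists n; rewrite VE => y /sVW /=; rewrite gK.
Qed.

Lemma ext_equiv_sym (R : realType) (X : topologicalType)
    (Y1 Y2 : extension_space R X) :
  ext_equiv Y1 Y2 -> ext_equiv Y2 Y1.
Proof.
case=> h [ch [g [cg hK gK]]] hX; exists g; last by move=> x; rewrite -hX hK.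
by split => //; exists h.
Qed.

Lemma lambdaE (R : realType) (X : topologicalType)
    (E : one_point_extension R X) (Y : extension_space R X)
    (U : nat -> set X) :
  E Y -> extension_trace U -> generates U Y -> lambda E = trace_remainder R U.
Proof.
move=> EY tU gU; rewrite /lambda; case: xgetP => [Z _|]; last first.
  by move=> /(_ (trace_remainder R U)); case; exists Y, U.
move=> [Y' [V [EY' _ gV ->]]].
have {}gV : generates V Y.
  have [Y0 EE] := represented_class E; rewrite EE in EY EY'.
  apply: (generates_equiv EY); apply: (generates_equiv (ext_equiv_sym EY')).
  exact: gV.
apply/seteqP; split; apply: trace_remainder_sub.
- exact: generates_sub gU gV.
- exact: generates_sub gV gU.
Qed.

(* Main.v *)
Require Import Defs.
From HB Require Import structures.
From mathcomp Require Import all_boot all_order all_algebra.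
From mathcomp Require Import all_classical all_reals all_analysis.
From mathcomp Require Import lra.

(** Both sides of the equality are described by the same objects: the positive
    continuous functions f on X taking arbitrarily small values, through the
    decreasing sequence of open sets {f < 1/(n+1)}.

    - An extension Y = X u {p} with metric d is generated by the sublevel sets
      of the function f x = d(x, p) ([exists_generating_sublevel]).
      Conversely, every such f comes from an extension: if d metrizes X, then
      adding a point p at distance f x from each x, and shortcutting distances
      in X through p, gives a metric on X u {p} ([is_metric_adjoin_dist]) which
      still induces the topology of X ([exists_extension_of_sublevel]).

    - If g is a nonnegative continuous function on beta X which is positive on
      X, then the trace of its sublevel sets in the remainder is exactly the
      zero-set of g ([trace_remainder_sublevel]): the closures of the sublevel
      sets lie in {g <= 1/(n+1)}, and density of X in beta X gives the other
      inclusion.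

    Hence for an extension Y with distance f to p, lambda Y is the zero-set of
    the extension to beta X of min(1, f), whose sublevel sets on X are those of
    f; it misses X because f is positive, and it is nonempty because a
    nonnegative continuous function on a compact space with infimum 0 vanishes
    somewhere. For a nonempty zero-set g^-1(0) missing X, the function |g|
    restricted to X is positive and, by density of X, takes arbitrarily small
    values, so it comes from an extension, whose image under lambda is
    |g|^-1(0). *)

Set Implicit Arguments.
Unset Strict Implicit.
Unset Printing Implicit Defensive.

Import Order.TTheory GRing.Theory Num.Theory.
Import numFieldNormedType.Exports.

Local Open Scope classical_set_scope.
Local Open Scope ring_scope.

(** * Metrics *)

Lemma is_metric_ge0 (R : realType) (T : Type) (d : T -> T -> R) :
  is_metric d -> forall x y, 0 <= d x y.
Proof.
case=> d0 _ dC dD x y; have := dD y x x.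
by rewrite d0 (dC y x) -mulr2n pmulrn_lge0.
Qed.

Lemma is_metric_gt0 (R : realType) (T : Type) (d : T -> T -> R) :
  is_metric d -> forall x y, x <> y -> 0 < d x y.
Proof.
move=> dm x y xy; rewrite lt_neqAle is_metric_ge0// andbT eq_sym.
by apply/eqP => dxy; apply: xy; case: dm => _ dI _ _; exact: dI.
Qed.

Definition metrizes (R : realType) (T : topologicalType) (d : T -> T -> R) :=
  is_metric d /\
  forall x,
    nbhs x = filter_from [set e : R | 0 < e] (fun e => [set y | d x y < e]).

Lemma dist_continuous (R : realType) (T : topologicalType) (d : T -> T -> R) :
  metrizes d -> forall p, continuous (fun x => d x p).
Proof.
move=> [[_ _ dC dD] dn] p x; apply/cvgrPdist_lt => e e0.
have : nbhs x [set y | d x y < e] by rewrite dn; exists e.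
apply: filterS => y /= dxy; have := dD y x p; have := dD x y p.
rewrite (dC y x) ltr_distl => H1 H2; apply/andP; split; lra.
Qed.

(** A copy of T, so that the topology of d does not compete with a topology
    that T may already carry; the proof [dm] is a parameter so that the instance
    below can read the metric off the type. *)
Definition metric_copy (R : realType) (T : choiceType) (d : T -> T -> R)
  (dm : is_metric d) : Type := T.

HB.instance Definition _ (R : realType) (T : choiceType) (d : T -> T -> R)
  (dm : is_metric d) := Choice.on (metric_copy dm).

HB.instance Definition _ (R : realType) (T : choiceType) (d : T -> T -> R)
    (dm : is_metric d) :=
  isMetric.Build R (metric_copy dm)
    (let: And4 d0 _ _ _ := dm in d0) (let: And4 _ dI _ _ := dm in dI)
    (let: And4 _ _ dC _ := dm in dC) (let: And4 _ _ _ dD := dm in dD).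

Lemma nbhs_metric_copy (R : realType) (T : choiceType) (d : T -> T -> R)
    (dm : is_metric d) (x : metric_copy dm) :
  nbhs x = filter_from [set e : R | 0 < e] (fun e => [set y | d x y < e]).
Proof. by rewrite -metricType_numDomainType.nbhs_nbhs_mdist. Qed.

(** * Sublevel sets as extension traces *)

Definition sublevel (R : realType) (X : Type) (f : X -> R) (n : nat) : set X :=
  [set x | f x < n.+1%:R^-1].

Lemma lt_invS (R : realType) (n : nat) : n.+2%:R^-1 < n.+1%:R^-1 :> R.
Proof. by rewrite ltf_pV2 ?posrE// ltr_nat. Qed.

Lemma ex_invS_lt (R : realType) (e : R) : 0 < e -> exists n, n.+1%:R^-1 < e.
Proof.
move=> e0; have [n ne] := ltr_add_invr (y := 0) (x := e) e0.
by exists n; move: ne; rewrite add0r.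
Qed.

Lemma open_sublevel (R : realType) (X : topologicalType) (f : X -> R) n :
  continuous f -> open (sublevel f n).
Proof.
by move=> cf; apply: (@open_comp _ _ f [set y | y < n.+1%:R^-1]).
Qed.

Lemma closure_sublevel (R : realType) (X : topologicalType) (f : X -> R) n :
  continuous f -> closure (sublevel f n) `<=` [set x | f x <= n.+1%:R^-1].
Proof.
move=> cf; have cl : closed [set x | f x <= n.+1%:R^-1].
  by apply: (@preimage_closed _ _ f [set y | y <= n.+1%:R^-1]).
by apply: subset_trans cl; apply: closureS => x /ltW.
Qed.

Lemma sublevel_extension_trace (R : realType) (X : topologicalType)
    (f : X -> R) :
  continuous f -> (forall x, 0 < f x) ->
  (forall e, 0 < e -> exists x, f x < e) ->
  extension_trace (sublevel f).
Proof.
move=> cf f0 fe; split=> [n|n|n x /(closure_sublevel cf) /= fx|].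
- by have [|x fx] := fe n.+1%:R^-1; [rewrite invr_gt0|exists x].
- exact: open_sublevel.
- by apply: le_lt_trans fx _; exact: lt_invS.
- apply/seteqP; split => // x Ux; have [n nf] := ex_invS_lt (f0 x).
  by have /(lt_trans nf) := Ux n I; rewrite ltxx.
Qed.

(** * The Stone-Cech compactification *)

Lemma set_val_continuous (T : topologicalType) (A : set T) :
  continuous (set_val : A -> T).
Proof. exact: initial_continuous. Qed.

Lemma continuous_to_set_type (S T : topologicalType) (A : set T) (h : S -> A) :
  continuous (set_val \o h) -> continuous h.
Proof.
move=> /continuousP ch; apply/continuousP => _ [B oB <-].
by rewrite -comp_preimage; exact: ch.
Qed.

Lemma compact_set_type (T : topologicalType) (A : set T) :
  compact A -> compact [set: A].
Proof.
move=> cA F FF _.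
have [|t [At Ft]] := cA (set_val @ F).
  by rewrite /nbhs/=; apply: (@filterE _ F) => x; exact: set_valP.
have cl : cluster F (SigSub (mem_set At)).
  move=> B V FB [_ [[C oC <-] Ct CV]].
  have FB' : (set_val @ F) (set_val @` B).
    by apply: (@filterS _ F _ B) => // x Bx; exists x.
  have [_ [[y By <-] Cy]] := Ft _ _ FB' (open_nbhs_nbhs (conj oC Ct)).
  by exists y; split => //; exact: CV.
by exists (SigSub (mem_set At)).
Qed.

Lemma continuous_to_prod (S : topologicalType) (I : Type)
    (T : I -> topologicalType) (h : S -> prod_topology T) :
  (forall i, continuous (fun x => h x i)) -> continuous h.
Proof.
move=> ch x; apply/cvg_sup => i A [_ [[B oB <-] Bx AB]].
apply: filterS AB _; apply: (ch i x); exact: open_nbhs_nbhs.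
Qed.

Lemma sc_incl_continuous (R : realType) (X : topologicalType) :
  continuous (sc_incl R : X -> stone_cech R X).
Proof.
apply: continuous_to_set_type.
apply: (@continuous_to_prod X _ (fun=> unit_interval R)) => f.
exact: cts_fun.
Qed.

Lemma closure_range_sc_incl (R : realType) (X : topologicalType) :
  closure (range (@sc_incl R X)) = setT.
Proof.
apply/seteqP; split=> // -[z /= zX] _ B [_ [[C oC <-] Cz CB]].
have [_ [[x _ <-] Cx]] := set_mem zX _ (open_nbhs_nbhs (conj oC Cz)).
by exists (sc_incl R x); split; [exists x|exact: CB].
Qed.

Lemma stone_cech_compact (R : realType) (X : topologicalType) :
  compact [set: stone_cech R X].
Proof.
apply: compact_set_type.
apply: (@subclosed_compact _ _ [set: sc_cube R X]) => //.
  exact: closed_closure.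
have -> : [set: sc_cube R X] = [set h | forall i, [set: unit_interval R] (h i)].
  by apply/seteqP.
apply: (@tychonoff (continuousType X (unit_interval R)) (fun=> unit_interval R)
  (fun=> [set: unit_interval R])) => _.
exact/compact_set_type/segment_compact.
Qed.

(** A function with values in [0, 1] is one of the coordinates of the cube, so
    that the projection to this coordinate extends it. *)
Lemma stone_cech_extend (R : realType) (X : topologicalType) (f : X -> R) :
  continuous f -> (forall x, 0 <= f x <= 1) ->
  exists g : stone_cech R X -> R,
    [/\ continuous g, forall z, 0 <= g z & forall x, g (sc_incl R x) = f x].
Proof.
move=> cf f01.
have fP x : f x \in (`[0, 1]%classic : set R) by rewrite inE/= in_itv/= f01.
pose F x : unit_interval R := SigSub (fP x).
have cF : continuous F by apply: continuous_to_set_type.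
pose Fc : continuousType X (unit_interval R) :=
  HB.pack_for (continuousType X (unit_interval R)) F
    (isContinuous.Build _ _ F cF).
exists (fun z => set_val ((set_val z : sc_cube R X) Fc)); split=> // [z|z].
- apply: continuous_comp; last exact: set_val_continuous.
  apply: (@continuous_comp _ _ _ set_val (fun h : sc_cube R X => h Fc)).
    exact: set_val_continuous.
  exact: (@proj_continuous _ (fun=> unit_interval R) Fc).
- have := set_valP ((set_val z : sc_cube R X) Fc).
  by rewrite /= in_itv/= => /andP[].
Qed.

Lemma compact_zero_of_small_values (R : realType) (T : topologicalType)
    (g : T -> R) :
  compact [set: T] -> continuous g -> (forall z, 0 <= g z) ->
  (forall e, 0 < e -> exists z, g z < e) -> exists z, g z = 0.
Proof.
move=> cT cg g0 ge.
have cl : closed (range g).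
  apply: compact_closed; first exact: Rhausdorff.
  by apply: continuous_compact => //; exact: continuous_subspaceT.
suff : range g 0 by case=> z _ gz; exists z.
apply: cl => B /nbhs_ballP [e /= e0 eB]; have [z gz] := ge e e0.
exists (g z); split; first by exists z.
by apply: eB; rewrite /ball/= sub0r normrN ger0_norm.
Qed.

(** A point z with g z = 0 has the neighbourhood {g < 1/(n+1)}, which X meets
    densely, so z is in the closure of the trace of that set on X; a point in
    all the closures satisfies g z <= 1/(n+1) for every n. Positivity of g on X
    is what makes removing X from the closures harmless. *)
Lemma trace_remainder_sublevel (R : realType) (X : topologicalType)
    (g : stone_cech R X -> R) :
  continuous g -> (forall z, 0 <= g z) -> (forall x, 0 < g (sc_incl R x)) ->
  trace_remainder R (sublevel (g \o sc_incl R)) = g @^-1` [set 0].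
Proof.
move=> cg g0 gX; apply/seteqP; split=> [z Uz|z /= gz n _].
  apply/eqP; rewrite eq_le g0 andbT leNgt; apply/negP => /ex_invS_lt[n ngz].
  have [/closureS-/(_ (sublevel g n)) Uz' _] := Uz n I.
  have /(closure_sublevel cg) /= : closure (sublevel g n) z.
    by apply: Uz' => _ [x Ux <-].
  by rewrite leNgt ngz.
split; last by case=> x _ xz; move: (gX x); rewrite xz gz ltxx.
move=> B zB; have oU : nbhs z (sublevel g n).
  apply: open_nbhs_nbhs; split; first exact: open_sublevel.
  by rewrite /sublevel/= gz invr_gt0.
have := @closure_range_sc_incl R X; move/seteqP => [_ /(_ z I)].
move/(_ _ (filterI zB oU)) => [_ [[x _ <-] [Bx Ux]]].
by exists (sc_incl R x); split => //; exists x.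
Qed.

(** * Extensions generated by sublevel sets *)

Lemma sublevel_generates (R : realType) (X : topologicalType)
    (Y : extension_space R X) (d : Y -> Y -> R) :
  metrizes d ->
  generates (sublevel (fun x => d (ext_incl Y x) (ext_pt Y))) Y.
Proof.
move=> md; have [[d0 _ dC _] dn] := md.
have VE n : ext_incl Y @` sublevel (fun x => d (ext_incl Y x) (ext_pt Y)) n
    `|` [set ext_pt Y] = sublevel (d ^~ (ext_pt Y)) n.
  apply/seteqP; split=> [_ [[x Ux <-]//|->]|y Uy].
    by rewrite /sublevel/= d0 invr_gt0.
  have [[x _ xy]|yX] := pselect (range (ext_incl Y) y).
    by left; exists x; rewrite /sublevel //= xy.
  by right; rewrite -ext_compl.
split=> [n|W].
  by rewrite VE; apply: open_sublevel; exact: dist_continuous.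
rewrite dn => -[e /= e0 eW]; have [n ne] := ex_invS_lt e0.
by exists n; rewrite VE => y Uy; apply: eW; rewrite /= dC (lt_trans Uy).
Qed.

Lemma ext_incl_continuous (R : realType) (X : topologicalType)
    (Y : extension_space R X) : continuous (ext_incl Y).
Proof.
apply/continuousP => A oA; have [_ oE] := ext_embedding Y.
by rewrite oE; exists A.
Qed.

Lemma ext_incl_neq_pt (R : realType) (X : topologicalType)
    (Y : extension_space R X) x : ext_incl Y x <> ext_pt Y.
Proof.
move=> xp; have : (~` range (ext_incl Y)) (ext_pt Y) by rewrite ext_compl.
by apply; exists x.
Qed.

(** The point [None] is put at distance f x from x. This is consistent only if f
    is 1-Lipschitz, which holds after replacing d by d x y + |f x - f y|; the
    minimum with f x + f y allows paths through the new point and so restores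
    the triangle inequality f x + f y >= dist(x, y). *)
Definition adjoin_dist (R : realType) (X : Type) (d : X -> X -> R) (f : X -> R)
    (u v : option X) : R :=
  match u, v with
  | Some x, Some y => Num.min (d x y + `|f x - f y|) (f x + f y)
  | Some x, None => f x
  | None, Some y => f y
  | None, None => 0
  end.

Lemma is_metric_adjoin_dist (R : realType) (X : Type) (d : X -> X -> R)
    (f : X -> R) :
  is_metric d -> (forall x, 0 < f x) -> is_metric (adjoin_dist d f).
Proof.
move=> dm f0; have [d0 dI dC dD] := dm; have dp := is_metric_ge0 dm.
split.
- case=> [x|]//=; rewrite d0 subrr normr0 addr0.
  by apply/min_idPl; rewrite addr_ge0// ltW.
- case=> [x|] [y|]//=; last 2 first.
  + by move=> fx; move: (f0 x); rewrite fx ltxx.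
  + by move=> fy; move: (f0 y); rewrite fy ltxx.
  move=> m0; congr Some; apply: dI; have := dp x y; have := f0 x; have := f0 y.
  have := normr_ge0 (f x - f y).
  by move: m0; rewrite /Order.min; case: ifP => _; lra.
- case=> [x|] [y|]//=.
  by rewrite dC distrC (addrC (f x)).
- case=> [y|] [x|] [z|] /=; rewrite ?addr0 ?add0r//.
  + have := dD y x z; have := ler_distD (f y) (f x) (f z).
    have := f0 x; have := f0 y; have := f0 z.
    have := ler_norm (f x - f y); have := ler_norm (f y - f x).
    have := ler_norm (f y - f z); have := ler_norm (f z - f y).
    have := dp x y; have := dp y z.
    rewrite (distrC (f y) (f x)) (distrC (f z) (f y)) /Order.min.
    by case: ifPn; case: ifPn; case: ifPn; rewrite -?leNgt; lra.
  + have := ler_norm (f x - f y); have := f0 y; have := dp x y.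
    by rewrite /Order.min; case: ifPn; lra.
  + have := ler_norm (f z - f y); have := f0 y; have := dp y z.
    by rewrite distrC /Order.min; case: ifPn; lra.
  + by rewrite addr_ge0// ltW.
  + by rewrite ge_min lexx orbT.
Qed.

(** Positivity of f keeps the added point away from each point of X, so that the
    topology of X is unchanged; small values of f make X dense. *)
Lemma exists_extension_of_sublevel (R : realType) (X : topologicalType)
    (d : X -> X -> R) (f : X -> R) :
  metrizes d -> continuous f -> (forall x, 0 < f x) ->
  (forall e, 0 < e -> exists x, f x < e) ->
  exists Y : extension_space R X, generates (sublevel f) Y.
Proof.
move=> [dm dn] cf f0 fe; have Dm := is_metric_adjoin_dist dm f0.
pose Y : topologicalType := metric_copy Dm; pose i x : Y := Some x.
have Ymet : metrizable R Y.
  by exists (adjoin_dist d f) => // y; exact: nbhs_metric_copy.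
have ci : continuous i.
  move=> x W; rewrite [nbhs (i x)]nbhs_metric_copy => -[e /= e0 eW].
  have e20 : 0 < e / 2 by rewrite divr_gt0.
  have dx : nbhs x [set y | d x y < e / 2] by rewrite dn; exists (e / 2).
  have fx : nbhs x [set y | `|f x - f y| < e / 2].
    by have /cvgrPdist_lt/(_ _ e20) := cf x.
  apply: (@filterS _ (nbhs x) _ _ _ _ (filterI dx fx)) => y [/= dxy fxy].
  by apply: eW; rewrite /= gt_min; apply/orP; left; lra.
have ei : topological_embedding i.
  split; first by move=> x y [].
  apply/seteqP; split=> [A oA|_ [B oB <-]]; last by move/continuousP: ci; apply.
  exists (i @` A); last first.
    by apply/seteqP; split=> [x [y Ay [<-]]//|x Ax]; exists x.
  rewrite openE => _ [x Ax <-]; rewrite /interior nbhs_metric_copy.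
  have : nbhs x A by apply: open_nbhs_nbhs.
  (* Within f x of Some x, the shortcut through the added point is too long to
     be the shortest path, so only the term d x y + |f x - f y| matters. *)
  rewrite dn => -[e /= e0 eA]; exists (Num.min e (f x)) => /=.
    by rewrite lt_min e0 f0.
  case=> [y|] /=; last by rewrite lt_min ltxx andbF.
  rewrite lt_min gt_min [X in _ && X]gt_min => /andP[/orP h1 /orP h2].
  exists y => //; apply: eA => /=; have := f0 y; have := normr_ge0 (f x - f y).
  by case: h1; case: h2; lra.
have di : dense (range i).
  move=> O [[x|] Ox] oO; first by exists (i x); split => //; exists x.
  have : nbhs (None : Y) O by apply: open_nbhs_nbhs.
  rewrite nbhs_metric_copy => -[e /= e0 eO]; have [x fx] := fe e e0.
  by exists (i x); split; [exact: eO|exists x].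
have pi : ~` range i = [set (None : Y)].
  by apply/seteqP; split=> [[x|]//= []|_ -> []//]; exists x.
exists (ExtensionSpace Ymet ei di pi).
apply: (@sublevel_generates R X (ExtensionSpace Ymet ei di pi)
  (adjoin_dist d f)).
by split=> // y; exact: nbhs_metric_copy.
Qed.

Lemma ext_equiv_refl (R : realType) (X : topologicalType)
    (Y : extension_space R X) : ext_equiv Y Y.
Proof.
by exists id => //; split; [move=> x|exists id; split=> // x].
Qed.

Lemma exists_generating_sublevel (R : realType) (X : topologicalType)
    (Y : extension_space R X) :
  exists f : X -> R, [/\ continuous f, (forall x, 0 < f x),
    (forall e, 0 < e -> exists x, f x < e) & generates (sublevel f) Y].
Proof.
have [d dm dn] := ext_metrizable Y; have md : metrizes d by [].
exists (fun x => d (ext_incl Y x) (ext_pt Y)); split.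
- move=> x; apply: (@continuous_comp _ _ _ (ext_incl Y) (d ^~ (ext_pt Y))).
    exact: ext_incl_continuous.
  exact: dist_continuous.
- by move=> x; apply: (is_metric_gt0 dm); exact: ext_incl_neq_pt.
- move=> e e0.
  have oB : open [set y | d y (ext_pt Y) < e].
    by apply: (@open_comp _ _ (d ^~ (ext_pt Y)) [set r | r < e]) => //;
      move=> y _; exact: dist_continuous.
  have [|y [/= de [x _ xy]]] := ext_dense _ oB.
    by exists (ext_pt Y) => /=; case: dm => ->.
  by exists x; rewrite xy.
- exact: sublevel_generates.
Qed.

(** * The image of lambda *)

Theorem theorem2p2 (R : realType) (X : topologicalType)
    (Xmetrizable : metrizable R X)
    (Xlocally_compact : locally_compact [set: X])
    (Xnoncompact : ~ compact [set: X]) :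
  [set Z | exists Y : one_point_extension R X, lambda Y = Z] =
  [set Z : set (stone_cech R X) |
    [/\ zero_sets R (stone_cech R X) Z, Z !=set0 &
        Z `&` range (sc_incl R) = set0]].
Proof.
apply/seteqP; split=> [_ [E <-]|Z [[g cg ->] [z0 gz0] gX]] /=.
  have [Y EE] := represented_class E.
  have EY : E Y by rewrite EE; exact: ext_equiv_refl.
  have [f [cf f0 fe fY]] := exists_generating_sublevel Y.
  have tf := sublevel_extension_trace cf f0 fe.
  rewrite (lambdaE EY tf fY).
  have [||g [cg g0 gf]] := @stone_cech_extend R X (fun x => Num.min 1 (f x)).
  - by move=> x; apply: continuous_min; [exact: cst_continuous|exact: cf].
  - by move=> x; rewrite le_min ler01 ltW//= ge_min lexx.
  have gX x : 0 < g (sc_incl R x) by rewrite gf lt_min ltr01 f0.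
  (* All thresholds 1/(n+1) are at most 1, so truncating f at 1 changes no
     sublevel set. *)
  have -> : sublevel f = sublevel (g \o sc_incl R).
    apply/funext => n; apply/seteqP; split=> x; rewrite /sublevel/= gf gt_min.
      by move=> ->; rewrite orbT.
    by case/orP => //; rewrite ltNge invf_le1// ler1n.
  rewrite trace_remainder_sublevel//; split; first by exists g.
    apply: (compact_zero_of_small_values _ cg g0) => [|e e0].
      exact: stone_cech_compact.
    have [x fx] := fe e e0; exists (sc_incl R x).
    by rewrite gf gt_min fx orbT.
  apply/seteqP; split=> // z [/= gz [x _ xz]].
  by move: (gX x); rewrite xz gz ltxx.
have [d dm dn] := Xmetrizable.
pose h z : R := `|g z|.
have ch : continuous h.
  by move=> z; apply: continuous_comp; [exact: cg|exact: norm_continuous].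
have h0 z : 0 <= h z by exact: normr_ge0.
have hX x : 0 < h (sc_incl R x).
  rewrite normr_gt0; apply/eqP => gx.
  by have : set0 (sc_incl R x) by rewrite -gX; split=> //; exists x.
have chX : continuous (h \o sc_incl R).
  by move=> x; apply: continuous_comp; [exact: sc_incl_continuous|exact: ch].
have hs e : 0 < e -> exists x, (h \o sc_incl R) x < e.
  move=> e0; have := @closure_range_sc_incl R X => /seteqP [_ /(_ z0 I)].
  have oB : open [set z | h z < e].
    by apply: (@open_comp _ _ h [set r | r < e]) => // z _; exact: ch.
  have hz0 : h z0 < e by rewrite /h (_ : g z0 = 0)// normr0.
  case/(_ _ (open_nbhs_nbhs (conj oB hz0))) => _ [[x _ <-] hx].
  by exists x.
have [Y hY] := exists_extension_of_sublevel (conj dm dn) chX hX hs.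
have classY : exists Y', ext_equiv Y = ext_equiv Y' by exists Y.
exists (OnePointExtension classY).
rewrite (@lambdaE R X (OnePointExtension classY) Y _ (ext_equiv_refl Y)
  (sublevel_extension_trace chX hX hs) hY).
rewrite trace_remainder_sublevel//; apply/seteqP; split=> z /=; rewrite /h.
  by move/normr0_eq0.
by move=> ->; rewrite normr0.
Qed.
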